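(* Let $t_0>0$, let $\phi$ be the solution cocycle of $dY_t=F(Y_t)\,d\mathbf Z_t(\omega)+F_0(Y_t)\,dt$ driven by an $\mathbf X$-controlled rough path cocycle $\mathbf Z$, with $F\in C_b^3(W,\mathcal L(U,W))$, $F_0\in C_b^1(W,W)$, let $\mathcal Z(\omega)$ be the canonical lift of $\mathbf Z(\omega)$, and let $Y:\Omega\to W\times\mathcal L(V,W)$ be the stationary point of $\phi$. Let $Q_{\mathrm{nl}}:\mathbb R_{\ge0}^3\to\mathbb R_{\ge0}$ be an increasing polynomial-type function such that for all $\omega$, all $y,z\in W\times\mathcal L(V,W)$ and $\rho\in(0,1]$ with $\|z\|\le\rho$, $$\sup_{0\le t\le t_0}\|D_{y+z}\phi_t^\omega-D_y\phi_t^\omega\|\le\exp\Bigl(Q_{\mathrm{nl}}\bigl(\|y\|+\rho,\|\mathcal Z(\omega)\|_{\alpha,[0,t_0]},\|\mathbf Z(\omega)\|_{\mathcal C^\alpha_{\mathbf X(\omega)}([0,t_0])}\bigr)\Bigr)\|z\|.$$ Assume that 1. $Y\in\bigcap_{p\ge1}L^p(\Omega;W\times\mathcal L(V,W))$; 2. $\|\mathcal Z(\omega)\|_{\alpha,[0,t_0]}\in\bigcap_{p\ge1}L^p(\Omega)$ and $\|\mathbf Z(\omega)\|_{\mathcal C^\alpha_{\mathbf X(\omega)}([0,t_0])}\in\bigcap_{p\ge1}L^p(\Omega)$. Then the random variable $$f_{\mathrm{nl}}(\omega):=\exp\Bigl(Q_{\mathrm{nl}}\bigl(\|Y_\omega\|+1,\|\mathcal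 Z(\omega)\|_{\alpha,[0,t_0]},\|\mathbf Z(\omega)\|_{\mathcal C^\alpha_{\mathbf X(\omega)}([0,t_0])}\bigr)\Bigr)$$ is $\theta_{t_0}$-tempered, i.e. $\lim_{|n|\to\infty}\frac1{|n|}\log^+f_{\mathrm{nl}}(\theta_{nt_0}\omega)=0$ for almost every $\omega$.
   Context: $U,V,W$ are finite-dimensional Banach spaces, $\alpha\in(1/3,1/2]$, $X_{s,t}:=X_t-X_s$, $\log^+x=\max\{\log x,0\}$ (with $\log^+0=0$). $C_b^k$: $k$-times continuously differentiable maps with bounded derivatives up to order $k$. ''Increasing polynomial-type function'': nondecreasing in each argument and of at most polynomial growth. $(\Omega,\mathcal F,\mathbb P,\{\theta_t\}_{t\in\mathbb R})$ is an invertible measure-preserving dynamical system (jointly measurable group of $\mathbb P$-preserving maps). Rough path on an interval $I$: $\mathbf X=(X,\mathbb X)$, $X$ $V$-valued, $\mathbb X$ $V\otimes V$-valued, $\mathbb X_{s,t}=\mathbb X_{s,u}+\mathbb X_{u,t}+X_{s,u}\otimes X_{u,t}$, $\|\mathbf X\|_{\alpha,I}:=\max\{\|X\|_{\alpha,I},\|\mathbb X\|_{2\alpha,I}^{1/2}\}<\infty$. $\mathbf X$-controlled path: $\mathbf Z=(Z,Z')$ with $R^Z_{s,t}:=Z_{s,t}-Z'_sX_{s,t}$ and $\|\mathbf Z\|_{\mathcal C^\alpha_{\mathbf X}(I)}:=\max\{\|Z\|_{\infty,I},\|Z'\|_{\infty,I},\|R^Z\|_{2\alpha,I},\|Z'\|_{\alpha,I}\}<\infty$.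 On $\mathbb R$ these are required on every compact interval. Canonical lift: $\mathcal Z=(Z,\mathbb Z)$ with $\mathbb Z_{s,t}:=\lim\sum_{[u,v]}\bigl(Z_{s,u}\otimes Z_{u,v}+(Z'_u\otimes Z'_u)\mathbb X_{u,v}\bigr)$ over partitions of $[s,t]$. Rough path cocycle: random process $\mathbf X$ of rough paths on $\mathbb R$ with $X_{s,s+t}(\omega)=X_{0,t}(\theta_s\omega)$, $\mathbb X_{s,s+t}(\omega)=\mathbb X_{0,t}(\theta_s\omega)$ ($s\in\mathbb R,t\ge0$). $\mathbf X$-controlled rough path cocycle: random process $\mathbf Z=(Z,Z')$ with values in $U\times\mathcal L(V,U)$, $\mathbf Z(\omega)$ being $\mathbf X(\omega)$-controlled, $Z_{s,s+t}(\omega)=Z_{0,t}(\theta_s\omega)$, $Z'_{s+t}(\omega)=Z'_t(\theta_s\omega)$. Solution cocycle: for $y\in W$ let $(Y,Y')$ be the unique $\mathbf X(\omega)$-controlled path with $Y_t=y+\int_0^tF(Y_r)\,d\mathbf Z_r(\omega)+\int_0^tF_0(Y_r)\,dr$, $Y'_t=F(Y_t)Z'_t(\omega)$, where $\int F(Y)\,d\mathbf Z:=\lim\sum_{[u,v]}(F(Y_u)Z_{u,v}+DF(Y_u)Y'_uZ'_u\mathbb X_{u,v})$. Put $\phi_t^\omega(y):=(Y_t,Y'_t)$; for $(y,y')\in W\times\mathcal L(V,W)$, $\phi_t^\omega(y,y'):=\phi_t^\omega(y)$. As a standing assumption, $\phi_t^\omega$ is of class $C^1$. Stationary point (standing): a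 measurable $Y:\Omega\to W\times\mathcal L(V,W)$ with $\phi_t^\omega(Y_\omega)=Y_{\theta_t\omega}$ for $t\ge0$, obtained as the pull-back limit $\lim_{t\to\infty}\phi_t^{\theta_{-t}\omega}(\mathbf Y_0(\omega))$, independent of the initial condition $\mathbf Y_0$. *)

(* Defs.v *)
From HB Require Import structures.
From mathcomp Require Import all_boot all_order all_algebra.
From mathcomp Require Import all_classical all_reals all_analysis.

Set Implicit Arguments.
Unset Strict Implicit.
Unset Printing Implicit Defensive.

Import Order.TTheory GRing.Theory Num.Def Num.Theory.
Import numFieldNormedType.Exports.

Local Open Scope classical_set_scope.
Local Open Scope ring_scope.

Definition opnorm (R : realType) (V W : normedModType R) (f : V -> W) : R :=
  sup [set `|f x| | x in [set x : V | `|x| <= 1]].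

Section LinCont.
Context (R : realType) (V W : normedModType R).

Definition lincont_pred : {pred V -> W} :=
  mem [set f : V -> W | linear f /\ continuous f].

Record lincont := LinCont {
  lincont_fun :> V -> W;
  lincont_subproof : lincont_fun \in lincont_pred }.

HB.instance Definition _ := [isSub for lincont_fun].
HB.instance Definition _ := [Choice of lincont by <:].

Lemma lincont_linear (f : lincont) : linear f.
Proof. by have := lincont_subproof f; rewrite inE => -[]. Qed.

Lemma lincont_continuous (f : lincont) : continuous f.
Proof. by have := lincont_subproof f; rewrite inE => -[]. Qed.

HB.instance Definition _ (f : lincont) :=
  GRing.isLinear.Build R V W *:%R (lincont_fun f) (lincont_linear f).

Lemma lincont_submod : submod_closed lincont_pred.
Proof.
split.
  rewrite inE; split => [a x y|]; first by rewrite /= scaler0 addr0.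
  exact: (@cst_continuous V W 0).
move=> a f g; rewrite !inE => -[lf cf] [lg cg]; split.
  move=> b x y; rewrite !fctE lf lg !scalerDr !scalerA mulrC !addrA.
  by congr (_ + _); rewrite -!addrA; congr (_ + _); rewrite addrC.
move=> x; apply: cvgD; last exact: cg.
by apply: cvgZl_tmp; exact: cf.
Qed.

HB.instance Definition _ :=
  GRing.isSubmodClosed.Build R (V -> W) lincont_pred lincont_submod.
HB.instance Definition _ :=
  [SubChoice_isSubLmodule of lincont by <:].

Let vals (f : V -> W) := [set `|f x| | x in [set x : V | `|x| <= 1]].

Let vals0 (f : V -> W) : vals f !=set0.
Proof. by exists `|f 0|; exists 0 => //=; rewrite normr0. Qed.

Lemma lincont_has_sup (f : lincont) :
  has_sup [set `|f x| | x in [set x : V | `|x| <= 1]].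
Proof.
split; first exact: vals0.
have /linear_bounded_continuous/bounded_funP/(_ 1)[M HM] :
  continuous (f : {linear V -> W}) by exact: lincont_continuous.
by exists M => _ [x /= x1 <-]; exact: HM.
Qed.

Lemma opnorm_ge (f : lincont) (x : V) : `|x| <= 1 -> `|f x| <= opnorm f.
Proof.
by move=> x1; apply: (ub_le_sup (lincont_has_sup f).2); exists x.
Qed.

Lemma opnorm_le (f : V -> W) (M : R) :
  (forall x, `|x| <= 1 -> `|f x| <= M) -> opnorm f <= M.
Proof. by move=> H; apply: ge_sup => [|_ [x x1 <-]]; [exact: vals0|exact: H]. Qed.

Lemma opnormD (f g : lincont) :
  opnorm (f + g : lincont) <= opnorm f + opnorm g.
Proof.
apply: opnorm_le => x x1.
by rewrite (le_trans (ler_normD _ _))// lerD// opnorm_ge.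
Qed.

Lemma opnorm_ge0 (f : lincont) : 0 <= opnorm f.
Proof.
by apply: le_trans (opnorm_ge f (x := 0) _); rewrite ?normr0.
Qed.

Lemma opnormZ (a : R) (f : lincont) : opnorm (a *: f : lincont) = `|a| * opnorm f.
Proof.
have le b (g : lincont) : opnorm (b *: g : lincont) <= `|b| * opnorm g.
  apply: opnorm_le => x x1.
  by rewrite /= normrZ ler_wpM2l// opnorm_ge.
apply/eqP; rewrite eq_le le andTb.
have [->|a0] := eqVneq a 0; first by rewrite normr0 mul0r; exact: opnorm_ge0.
rewrite -ler_pdivlMl ?normr_gt0//.
by rewrite -[in leLHS](scalerK a0 f) -normfV le.
Qed.

Lemma opnorm_eq0 (f : lincont) : opnorm f = 0 -> f = 0.
Proof.
move=> f0; apply/val_inj/funext => x /=.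
have [->|x0] := eqVneq x 0; first by rewrite linear0.
have : `|f (`|x|^-1 *: x)| <= 0.
  by rewrite -f0; apply: opnorm_ge; rewrite normfZV.
rewrite normr_le0 linearZ/= scaler_eq0 invr_eq0 normr_eq0 (negbTE x0)/=.
by move/eqP.
Qed.

HB.instance Definition _ :=
  Lmodule_isNormed.Build R lincont opnormD opnormZ opnorm_eq0.

End LinCont.

Notation "''L(' V , W )" := (lincont V W)
  (at level 8, format "''L(' V ,  W )") : type_scope.

Section Spaces.
Context (R : realType).

Definition finite_dim (E : lmodType R) : Prop :=
  exists (n : nat) (b : 'I_n -> E), forall x : E,
    exists c : 'I_n -> R, x = \sum_i c i *: b i.

(* [VV] with [t] is the tensor product of [V] with itself; a norm on [VV] is
   not prescribed, any two of them being equivalent in finite dimension. *)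
Definition is_tensor_square (V VV : lmodType R) (t : V -> V -> VV) : Prop :=
  bilinear_for *:%R *:%R t /\
  forall (G : lmodType R) (b : V -> V -> G), bilinear_for *:%R *:%R b ->
    exists! l : VV -> G, linear l /\ forall v w, l (t v w) = b v w.

(* The linear map on the tensor square induced by the bilinear map [b]. *)
Definition tensor_lift (V VV G : lmodType R)
    (t : V -> V -> VV) (b : V -> V -> G) : VV -> G :=
  xget (fun=> 0) [set l : VV -> G | linear l /\ forall v w, l (t v w) = b v w].

(* Only the derivatives of orders 1, ..., k are required to be bounded. *)
Fixpoint C_b (k : nat) (E G : normedModType R) (f : E -> G) : Prop :=
  continuous f /\
  if k isn't k'.+1 then True else
    exists Df : E -> 'L(E, G),
      [/\ forall x, is_diff x f (Df x),
          exists M : R, forall x, `|Df x| <= M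
        & C_b k' Df].

Definition C_1 (E G : normedModType R) (f : E -> G) : Prop :=
  exists Df : E -> 'L(E, G),
    (forall x, is_diff x f (Df x)) /\ continuous Df.

(* [Q] stands for a function on triples of nonnegative reals; its values
   elsewhere are irrelevant. *)
Definition increasing_polynomial_type (Q : R -> R -> R -> R) : Prop :=
  [/\ forall a b c, 0 <= a -> 0 <= b -> 0 <= c -> 0 <= Q a b c,
      forall a b c a' b' c', 0 <= a <= a' -> 0 <= b <= b' -> 0 <= c <= c' ->
        Q a b c <= Q a' b' c'
    & exists (C : R) (N : nat), forall a b c, 0 <= a -> 0 <= b -> 0 <= c ->
        Q a b c <= C * (1 + a + b + c) ^+ N].

End Spaces.

Section RoughPaths.
Context (R : realType).

Definition incr (E : zmodType) (x : R -> E) (s t : R) : E := x t - x s.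

Definition sup_norm (E : normedModType R) (x : R -> E) (I : set R) : \bar R :=
  ereal_sup [set `|x t|%:E | t in I].

Definition holder (E : normedModType R) (a : R) (x : R -> R -> E) (I : set R)
    : \bar R :=
  ereal_sup [set r | exists s t,
    [/\ I s, I t, s < t & r = (`|x s t| / (t - s) `^ a)%:E]].

Definition rough_norm (V VV : normedModType R) (alpha : R)
    (X : R -> V) (XX : R -> R -> VV) (I : set R) : \bar R :=
  maxe (holder alpha (incr X) I) ((holder (2 * alpha) XX I) `^ 2^-1)%E.

Definition is_rough_path (V VV : normedModType R) (tV : V -> V -> VV)
    (alpha : R) (X : R -> V) (XX : R -> R -> VV) : Prop :=
  (forall s u t, s <= u -> u <= t ->
     XX s t = XX s u + XX u t + tV (incr X s u) (incr X u t)) /\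
  (forall a b, a < b -> (rough_norm alpha X XX `[a, b] < +oo)%E).

Definition remainder (V E : normedModType R)
    (X : R -> V) (Z : R -> E) (Z' : R -> 'L(V, E)) (s t : R) : E :=
  incr Z s t - Z' s (incr X s t).

Definition controlled_norm (V E : normedModType R) (alpha : R)
    (X : R -> V) (Z : R -> E) (Z' : R -> 'L(V, E)) (I : set R) : \bar R :=
  maxe (maxe (sup_norm Z I) (sup_norm Z' I))
       (maxe (holder (2 * alpha) (remainder X Z Z') I)
             (holder alpha (incr Z') I)).

(* [J] is a possibly unbounded interval. *)
Definition is_controlled (V E : normedModType R) (alpha : R)
    (X : R -> V) (Z : R -> E) (Z' : R -> 'L(V, E)) (J : set R) : Prop :=
  forall a b, a < b -> `[a, b] `<=` J ->
    (controlled_norm alpha X Z Z' `[a, b] < +oo)%E.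

(* [l] is the limit of the sums of [xi u v] over the consecutive points [u], [v]
   of the partitions of [[s, t]], as their mesh tends to [0]; a partition
   [s = p_0 < ... < p_n = t] is given by the sequence [p_1, ..., p_n]. *)
Definition is_partition_lim (E : normedModType R) (s t : R)
    (xi : R -> R -> E) (l : E) : Prop :=
  forall e, 0 < e -> exists2 d, 0 < d & forall p : seq R, itv_partition s t p ->
    let q := nth t (s :: p) in
    (forall i, (i < size p)%N -> q i.+1 - q i < d) ->
    `|\sum_(0 <= i < size p) xi (q i) (q i.+1) - l| < e.

Definition is_canonical_lift (U V UU VV : normedModType R)
    (tU : U -> U -> UU) (tV : V -> V -> VV) (XX : R -> R -> VV)
    (Z : R -> U) (Z' : R -> 'L(V, U)) (ZZ : R -> R -> UU) : Prop :=
  forall s t, s <= t -> is_partition_lim s t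
    (fun u v => tU (incr Z s u) (incr Z u v) +
       tensor_lift tV (fun a b => tU (Z' u a) (Z' u b)) (XX u v))
    (ZZ s t).

(* The local expansion of the integral of [F(Y)] against [(Z, Z')]; the first
   tensor factor of [XX] is the one paired with the derivative of [Y]. *)
Definition rough_germ (U V W VV : normedModType R) (tV : V -> V -> VV)
    (XX : R -> R -> VV) (Z : R -> U) (Z' : R -> 'L(V, U))
    (F : W -> 'L(U, W)) (Y : R -> W) (Y' : R -> 'L(V, W)) (u v : R) : W :=
  F (Y u) (incr Z u v) +
  tensor_lift tV (fun a b => ('d F (Y u) (Y' u a) : 'L(U, W)) (Z' u b)) (XX u v).

Definition is_solution (U V W VV : normedModType R) (tV : V -> V -> VV)
    (alpha : R) (X : R -> V) (XX : R -> R -> VV)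
    (Z : R -> U) (Z' : R -> 'L(V, U)) (F : W -> 'L(U, W)) (F0 : W -> W)
    (y : W) (Y : R -> W) (Y' : R -> 'L(V, W)) : Prop :=
  [/\ is_controlled alpha X Y Y' `[0, +oo[,
      forall t, 0 <= t -> exists I0 I1 : W,
        [/\ is_partition_lim 0 t (rough_germ tV XX Z Z' F Y Y') I1,
            is_partition_lim 0 t (fun u v => (v - u) *: F0 (Y u)) I0
          & Y t = y + I1 + I0]
    & forall t, 0 <= t -> forall a : V, Y' t a = F (Y t) (Z' t a)].

End RoughPaths.

Section Cocycles.
Context (R : realType) (d : measure_display) (Omega : measurableType d).

Definition borel_measurable (E : normedModType R) (f : Omega -> E) : Prop :=
  forall A : set E, open A -> measurable (f @^-1` A).

Definition is_metric_dynamical_system (P : probability Omega R)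
    (theta : R -> Omega -> Omega) : Prop :=
  [/\ measurable_fun [set: R * Omega] (fun p => theta p.1 p.2),
      forall omega, theta 0 omega = omega,
      forall s t omega, theta (s + t) omega = theta s (theta t omega)
    & forall t (A : set Omega), measurable A -> P (theta t @^-1` A) = P A].

Definition is_rough_path_cocycle (V VV : normedModType R) (tV : V -> V -> VV)
    (alpha : R) (theta : R -> Omega -> Omega)
    (X : Omega -> R -> V) (XX : Omega -> R -> R -> VV) : Prop :=
  [/\ forall t, borel_measurable (X ^~ t),
      forall s t, s <= t -> borel_measurable (fun omega => XX omega s t),
      forall omega, is_rough_path tV alpha (X omega) (XX omega)
    & forall omega s t, 0 <= t ->
        incr (X omega) s (s + t) = incr (X (theta s omega)) 0 t /\
        XX omega s (s + t) = XX (theta s omega) 0 t].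

Definition is_controlled_cocycle (U V : normedModType R)
    (alpha : R) (theta : R -> Omega -> Omega) (X : Omega -> R -> V)
    (Z : Omega -> R -> U) (Z' : Omega -> R -> 'L(V, U)) : Prop :=
  [/\ forall t, borel_measurable (Z ^~ t),
      forall t, borel_measurable (Z' ^~ t),
      forall omega, is_controlled alpha (X omega) (Z omega) (Z' omega) setT
    & forall omega s t, 0 <= t ->
        incr (Z omega) s (s + t) = incr (Z (theta s omega)) 0 t /\
        Z' omega (s + t) = Z' (theta s omega) t].

Definition is_solution_cocycle (U V W VV : normedModType R)
    (tV : V -> V -> VV) (alpha : R)
    (X : Omega -> R -> V) (XX : Omega -> R -> R -> VV)
    (Z : Omega -> R -> U) (Z' : Omega -> R -> 'L(V, U))
    (F : W -> 'L(U, W)) (F0 : W -> W)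
    (phi : R -> Omega -> W -> W * 'L(V, W)) : Prop :=
  forall omega y,
    let sol := is_solution tV alpha (X omega) (XX omega) (Z omega) (Z' omega)
                 F F0 y in
    sol (fun t => (phi t omega y).1) (fun t => (phi t omega y).2) /\
    forall Y Y', sol Y Y' -> forall t, 0 <= t -> phi t omega y = (Y t, Y' t).

(* The extension of [phi] to pairs, which ignores the second component. *)
Definition pair_ext (W E : normedModType R) (phi : R -> Omega -> W -> W * E)
    (t : R) (omega : Omega) (y : W * E) : W * E := phi t omega y.1.

Definition is_stationary_point (E : normedModType R)
    (theta : R -> Omega -> Omega) (Phi : R -> Omega -> E -> E)
    (Y : Omega -> E) : Prop :=
  [/\ borel_measurable Y,
      forall omega t, 0 <= t -> Phi t omega (Y omega) = Y (theta t omega)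
    & forall Y0 : Omega -> E, borel_measurable Y0 -> forall omega,
        Phi t (theta (- t) omega) (Y0 omega) @[t --> +oo] --> Y omega].

Definition all_moments (P : probability Omega R) (f : Omega -> R) : Prop :=
  forall p : R, 1 <= p -> f \in Lfun P p%:E.

Definition logp (x : R) : R := Num.max (ln x) 0.

(* The filter [|n| --> oo] on the integers. *)
Definition infty_int : set_system int :=
  filter_from setT (fun N : nat => [set n : int | (N <= `|n|)%N]).

(* No measurability of [f] is required: the almost sure statement only needs
   the exceptional set to be contained in a measurable null set. *)
Definition is_tempered (P : probability Omega R)
    (theta : R -> Omega -> Omega) (t0 : R) (f : Omega -> R) : Prop :=
  {ae P, forall omega,
    `|n|%:R^-1 * logp (f (theta (n%:~R * t0) omega)) @[n --> infty_int] --> (0 : R)}.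

End Cocycles.

(* Main.v *)
Require Import Defs.
From HB Require Import structures.
From mathcomp Require Import all_boot all_order all_algebra.
From mathcomp Require Import all_classical all_reals all_analysis.
From mathcomp Require Import measurable_realfun ring lra.

Set Implicit Arguments.
Unset Strict Implicit.
Unset Printing Implicit Defensive.

Import Order.TTheory GRing.Theory Num.Def Num.Theory.
Import numFieldNormedType.Exports.

Local Open Scope classical_set_scope.
Local Open Scope ring_scope.

(** The theorem holds because a polynomial of functions with moments of all
    orders grows sublinearly along the orbits of a measure-preserving system.

    Put [G = 2 + |Y| + N1 + N2], with [N1] and [N2] the norms of the lift and of
    the driving path on [[0, t0]].  The arguments of [Q] being nonnegative,
    [log^+ (exp Q)] is [Q] itself, and it is at most [C G ^ (N + 1)] for some [C >= 0]
    and [N].  Every power of [G] is integrable, so [H = C G ^ (N + 1)] is square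
    integrable and the theorem reduces to [tempered_of_square_integrable]:
    [H (theta_(n t0) omega) / n] tends to [0] almost surely.

    The latter is the L^2 form of the Borel-Cantelli argument.  By invariance of
    the measure, every [H o theta_(n t0)] has the same second moment, so by
    Tonelli [\sum_n H (theta_(n t0) omega) ^ 2 / n ^ 2] has finite expectation.
    It is thus finite almost surely, and its terms tend to [0].  The same
    applies to the times [- n t0]. *)

Section MeasurePreserving.
Context (R : realType) (d : measure_display) (Omega : measurableType d).
Variable P : probability Omega R.

(** As [1 / n ^ 2 <= 1 / (n - 1) - 1 / n] for [n >= 2], the partial sums telescope to at most
    [2 - 1 / n].  The term of index [0] vanishes, inverses being total. *)
Lemma summable_inv_sqr : (\sum_(n <oo) ((n%:R^-1 : R) ^+ 2)%:E < +oo)%E.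
Proof.
have bnd n : \sum_(0 <= k < n.+2) ((k%:R^-1 : R) ^+ 2) <= 2 - n.+1%:R^-1.
  elim: n => [|n IH].
    by rewrite !big_nat_recr//= big_nil invr0 invr1 expr0n expr1n !add0r; lra.
  rewrite big_nat_recr//=.
  have a0 : 0 < n.+1%:R :> R by rewrite ltr0n.
  have -> : n.+2%:R = n.+1%:R + 1 :> R by rewrite -[n.+2]addn1 natrD.
  set a := n.+1%:R : R in IH a0 *.
  suff : (a + 1)^-1 ^+ 2 <= a^-1 - (a + 1)^-1.
    by move: IH; set b := (a + 1)^-1 ^+ 2; set c := (a + 1)^-1;
      set e := a^-1 => IH; move: (\sum_(_ <= _ < _) _) IH => S; lra.
  have -> : a^-1 - (a + 1)^-1 = a^-1 * (a + 1)^-1 by field; lra.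
  rewrite expr2 ler_pM2r ?invr_gt0; last by lra.
  by rewrite lef_pV2 ?posrE; lra.
apply: (@le_lt_trans _ _ 2%:E); last exact: ltry.
apply: lime_le.
  by apply: is_cvg_nneseries => n _ _; rewrite lee_fin sqr_ge0.
near=> n.
have n2 : (2 <= n)%N by near: n; exists 2.
rewrite sumEFin lee_fin -(subnK n2) addn2.
by apply: le_trans (bnd _) _; rewrite gerBl invr_ge0 ler0n.
Unshelve. all: by end_near. Qed.

Lemma integral_measure_preserving (T : Omega -> Omega) (f : Omega -> \bar R) :
  measurable_fun setT T ->
  (forall A, measurable A -> P (T @^-1` A) = P A) ->
  measurable_fun setT f -> (forall x, 0 <= f x)%E ->
  (\int[P]_x f (T x) = \int[P]_x f x)%E.
Proof.
move=> mT PT mf f0.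
rewrite -[LHS]/(\int[P]_(x in T @^-1` setT) (f \o T) x)%E.
rewrite -ge0_integral_pushforward//.
by apply: eq_measure_integral => A mA _; exact: PT.
Qed.

(** The expectation of [\sum_n (f (T n x) / n) ^ 2] is the second moment of [f]
    times [\sum_n 1 / n ^ 2], because the random variables [f o T n] all have the
    law of [f].  The maps [T n] need not be the iterates of one map, so that this
    covers both time directions. *)
Lemma sublinear_along_measure_preserving (T : nat -> Omega -> Omega)
    (f : Omega -> R) :
  (forall n, measurable_fun setT (T n)) ->
  (forall n A, measurable A -> P (T n @^-1` A) = P A) ->
  measurable_fun setT f ->
  (\int[P]_x (f x ^+ 2)%:E < +oo)%E ->
  {ae P, forall x, n%:R^-1 * f (T n x) @[n --> \oo] --> (0 : R)}.
Proof.
move=> mT PT mf f2.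
have mf2 : measurable_fun setT (fun x => (f x ^+ 2)%:E).
  by apply/measurable_EFinP; exact: measurable_funX.
pose g n x := (((n%:R^-1 : R) ^+ 2)%:E * (f (T n x) ^+ 2)%:E)%E.
have g0 n x : (0 <= g n x)%E by rewrite /g -EFinM lee_fin mulr_ge0// sqr_ge0.
have mfT n : measurable_fun setT (fun x => (f (T n x) ^+ 2)%:E).
  exact: (measurableT_comp mf2 (mT n)).
have mg n : measurable_fun setT (g n) by exact: measurable_funeM.
have Ig n : (\int[P]_x g n x =
    ((n%:R^-1 : R) ^+ 2)%:E * \int[P]_x (f x ^+ 2)%:E)%E.
  rewrite ge0_integralZl_EFin ?sqr_ge0//; last first.
    by move=> x _; rewrite lee_fin sqr_ge0.
  congr (_ * _)%E.
  apply: (@integral_measure_preserving (T n) (fun x => (f x ^+ 2)%:E)) => //.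
    exact: PT.
  by move=> x; rewrite lee_fin sqr_ge0.
have I0 : (0 <= \int[P]_x (f x ^+ 2)%:E)%E.
  by apply: integral_ge0 => x _; rewrite lee_fin sqr_ge0.
have Sfin : (\int[P]_x (\sum_(n <oo) g n x) < +oo)%E.
  rewrite integral_nneseries//.
  under eq_eseriesr do rewrite Ig muleC.
  have /fineK <- : (\int[P]_x (f x ^+ 2)%:E)%E \is a fin_num.
    by rewrite ge0_fin_numE.
  rewrite nneseriesZl; last by move=> i _; rewrite lee_fin sqr_ge0.
  by apply: lte_mul_pinfty; [rewrite lee_fin fine_ge0| |exact: summable_inv_sqr].
have S0 x : (0 <= \sum_(n <oo) g n x)%E by apply: nneseries_ge0.
have intS : P.-integrable setT (fun x => \sum_(n <oo) g n x)%E.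
  apply/integrableP; split.
    by apply: ge0_emeasurable_sum => // n x _ _.
  by under eq_integral do rewrite gee0_abs//.
have := integrable_ae measurableT intS.
apply: filterS => x /(_ I) Sx.
(* It is the squares that converge to [0], as the terms of a finite series. *)
have cv : (n%:R^-1 * f (T n x)) ^+ 2 @[n --> \oo] --> (0 : R).
  apply: cvg_series_cvg_0; apply: nnseries_is_cvg => [n|]; first exact: sqr_ge0.
  rewrite (_ : (fun n => _) = (fun n => \sum_(0 <= k < n) g k x)%E); last first.
    by apply/funext => n; apply: eq_bigr => k _; rewrite exprMn EFinM.
  by rewrite ltey_eq Sx.
apply/cvgr0Pnorm_lt => e e0.
have e20 : 0 < e ^+ 2 by rewrite exprn_gt0.
move/cvgr0Pnorm_lt : cv => /(_ _ e20).
apply: filterS => n; rewrite normrX ltr_pXn2r// nnegrE//; exact: ltW.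
Qed.

End MeasurePreserving.

Section Tempered.
Context (R : realType) (d : measure_display) (Omega : measurableType d).

Lemma cvg_infty_int (u : int -> R) (l : R) :
  u n%:Z @[n --> \oo] --> l -> u (- n%:Z) @[n --> \oo] --> l ->
  u n @[n --> @infty_int] --> l.
Proof.
move=> up un A Al; have [[N _ HN] [M _ HM]] := (up A Al, un A Al).
exists (maxn N M) => // n /=; rewrite geq_max => /andP[Nn Mn].
case: (intP n) Nn Mn => [|k|k] Nn Mn.
- exact: (HN 0%N).
- exact: (HN k.+1).
- exact: (HM k.+1).
Qed.

(** Along the orbit, [log^+ f] is squeezed between [0] and [H], whose growth is
    sublinear at the times [n t0] and [- n t0] alike. *)
Lemma tempered_of_square_integrable (P : probability Omega R)
    (theta : R -> Omega -> Omega) (t0 : R) (f H : Omega -> R) :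
  is_metric_dynamical_system P theta ->
  (forall omega, logp (f omega) <= H omega) ->
  measurable_fun setT H ->
  (\int[P]_x (H x ^+ 2)%:E < +oo)%E ->
  is_tempered P theta t0 f.
Proof.
move=> [mtheta _ _ Ptheta] fH mH H2.
have mth t : measurable_fun setT (theta t).
  exact: (measurableT_comp mtheta (measurable_pair1 t)).
have key (s : nat -> R) := sublinear_along_measure_preserving
  (fun n => mth (s n)) (fun n => @Ptheta (s n)) mH H2.
have := key (fun n => (- n%:Z)%:~R * t0); have := key (fun n => n%:Z%:~R * t0).
apply: filterS2 => omega cp cn.
have logp0 x : 0 <= logp x by rewrite /logp le_max lexx orbT.
apply: cvg_infty_int.
- apply: squeeze_cvgr cp; last exact: cvg_cst.
  by apply: nearW => n; rewrite mulr_ge0 ?invr_ge0 ?ler0n ?logp0// ler_wpM2l ?invr_ge0 ?ler0n.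
- apply: squeeze_cvgr cn; last exact: cvg_cst.
  by apply: nearW => n; rewrite abszN mulr_ge0 ?invr_ge0 ?ler0n ?logp0// ler_wpM2l ?invr_ge0 ?ler0n.
Qed.

End Tempered.

Section Moments.
Context (R : realType) (d : measure_display) (Omega : measurableType d).
Variable P : probability Omega R.

Lemma all_moments_cst (c : R) : all_moments P (cst c).
Proof. by move=> p _; exact: Lfun_cst. Qed.

Lemma all_momentsD (f g : Omega -> R) :
  all_moments P f -> all_moments P g -> all_moments P (f \+ g).
Proof.
move=> mf mg p p1; have p1E : (1 <= p%:E)%E by rewrite lee_fin.
exact: (Lfun_addr_closed P p1E).2 (mf p p1) (mg p p1).
Qed.

Lemma all_moments_measurable (f : Omega -> R) :
  all_moments P f -> measurable_fun setT f.
Proof. by move=> /(_ 1 (lexx 1))/sub_Lfun_mfun; rewrite inE. Qed.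

Lemma all_moments_powers (f : Omega -> R) (k : nat) :
  all_moments P f -> (\int[P]_x (`|f x| ^+ k.+1)%:E < +oo)%E.
Proof.
have k1 : 1 <= k.+1%:R :> R by rewrite ler1n.
move=> /(_ _ k1)/(Lfun_integrable k1)/integrableP[_].
by under eq_integral do rewrite gee0_abs ?lee_fin ?powR_ge0// powR_mulrn//.
Qed.

End Moments.

Section Norms.
Context (R : realType).

(** A supremum over an empty set would be [-oo]; it is the pair [(0, t)] that
    makes the seminorm nonnegative. *)
Lemma holder_itv_ge0 (E : normedModType R) (a : R) (x : R -> R -> E) (t : R) :
  0 < t -> (0 <= holder a x `[0%R, t])%E.
Proof.
move=> t0; apply: (@le_trans _ _ (`|x 0 t| / (t - 0) `^ a)%:E).
  by rewrite lee_fin divr_ge0// powR_ge0.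
apply: ereal_sup_ubound; exists 0, t; split=> //=.
all: by rewrite in_itv/= lexx ?ltW.
Qed.

Lemma rough_norm_itv_ge0 (V VV : normedModType R) (a : R)
    (X : R -> V) (XX : R -> R -> VV) (t : R) :
  0 < t -> (0 <= rough_norm a X XX `[0%R, t])%E.
Proof. by move=> t0; rewrite /rough_norm le_max holder_itv_ge0. Qed.

Lemma controlled_norm_itv_ge0 (V E : normedModType R) (a : R)
    (X : R -> V) (Z : R -> E) (Z' : R -> 'L(V, E)) (t : R) :
  0 < t -> (0 <= controlled_norm a X Z Z' `[0%R, t])%E.
Proof.
by move=> t0; rewrite /controlled_norm !le_max holder_itv_ge0// !orbT.
Qed.

End Norms.

Theorem proposition4p10 (R : realType)
    (U V W : completeNormedModType R)
    (hU : finite_dim U) (hV : finite_dim V) (hW : finite_dim W)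
    (UU VV : normedModType R) (tU : U -> U -> UU) (tV : V -> V -> VV)
    (htU : is_tensor_square tU) (htV : is_tensor_square tV)
    (alpha : R) (halpha : 1 / 3 < alpha <= 1 / 2)
    (d : measure_display) (Omega : measurableType d) (P : probability Omega R)
    (theta : R -> Omega -> Omega)
    (htheta : is_metric_dynamical_system P theta)
    (X : Omega -> R -> V) (XX : Omega -> R -> R -> VV)
    (hX : is_rough_path_cocycle tV alpha theta X XX)
    (Z : Omega -> R -> U) (Z' : Omega -> R -> 'L(V, U))
    (hZ : is_controlled_cocycle alpha theta X Z Z')
    (ZZ : Omega -> R -> R -> UU)
    (hZZ : forall omega,
      is_canonical_lift tU tV (XX omega) (Z omega) (Z' omega) (ZZ omega))
    (F : W -> 'L(U, W)) (hF : C_b 3 F) (F0 : W -> W) (hF0 : C_b 1 F0)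
    (phi : R -> Omega -> W -> W * 'L(V, W))
    (hphi : is_solution_cocycle tV alpha X XX Z Z' F F0 phi)
    (hphi1 : forall t omega, 0 <= t -> C_1 (pair_ext phi t omega))
    (Y : Omega -> W * 'L(V, W))
    (hY : is_stationary_point theta (pair_ext phi) Y)
    (t0 : R) (ht0 : 0 < t0)
    (Q : R -> R -> R -> R) (hQ : increasing_polynomial_type Q) :
  let NZZ := fun omega =>
    fine (rough_norm alpha (Z omega) (ZZ omega) `[0, t0]) in
  let NZ := fun omega =>
    fine (controlled_norm alpha (X omega) (Z omega) (Z' omega) `[0, t0]) in
  (forall omega (y z : W * 'L(V, W)) (rho : R),
     0 < rho <= 1 -> `|z| <= rho ->
     (ereal_sup [set (opnorm (('d (pair_ext phi t omega) (y + z) : _ -> _) \-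
                              ('d (pair_ext phi t omega) y : _ -> _)))%:E
                | t in `[0%R, t0]]
      <= (expR (Q (`|y| + rho) (NZZ omega) (NZ omega)) * `|z|)%:E)%E) ->
  all_moments P (fun omega => `|Y omega|) ->
  all_moments P NZZ ->
  all_moments P NZ ->
  is_tempered P theta t0
    (fun omega => expR (Q (`|Y omega| + 1) (NZZ omega) (NZ omega))).
Proof.
move=> NZZ NZ _ mY mNZZ mNZ.
have [Q0 _ [C [N QC]]] := hQ.
have NZZ0 omega : 0 <= NZZ omega by apply: fine_ge0; exact: rough_norm_itv_ge0.
have NZ0 omega : 0 <= NZ omega.
  by apply: fine_ge0; exact: controlled_norm_itv_ge0.
pose G omega := 1 + (`|Y omega| + 1) + NZZ omega + NZ omega.
have mG : all_moments P G.
  apply: all_momentsD => //; apply: all_momentsD => //.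
  apply: all_momentsD; first exact: all_moments_cst.
  by apply: all_momentsD => //; exact: all_moments_cst.
have G1 omega : 1 <= G omega.
  by rewrite /G -!addrA lerDl !addr_ge0.
(* The exponent [N + 1] instead of [N] makes it positive, so that the moment of
   [G] of order [2 (N + 1)] is among those of order at least [1]. *)
pose H omega := `|C| * G omega ^+ N.+1.
have measG := all_moments_measurable mG.
apply: (@tempered_of_square_integrable _ _ _ _ _ _ _ H) => //.
- move=> omega.
  have Y0 : 0 <= `|Y omega| + 1 by rewrite addr_ge0.
  rewrite /logp expRK ge_max; apply/andP; split; last first.
    by rewrite mulr_ge0// exprn_ge0// (le_trans _ (G1 omega)).
  apply: (le_trans (QC _ _ _ Y0 (NZZ0 omega) (NZ0 omega))).
  rewrite -/(G omega) (le_trans (ler_norm _))// normrM.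
  have Gn n : 0 <= G omega ^+ n by rewrite exprn_ge0// (le_trans _ (G1 omega)).
  by rewrite (ger0_norm (Gn N)) ler_wpM2l// ler_weXn2l.
- by apply: measurable_funM => //; exact: measurable_funX.
- under eq_integral => x _ do
    rewrite exprMn -exprM EFinM -[G x]ger0_norm ?(le_trans _ (G1 x))//.
  rewrite ge0_integralZl_EFin ?sqr_ge0//.
  + apply: lte_mul_pinfty; rewrite ?lee_fin ?sqr_ge0//.
    by rewrite (_ : (N.+1 * 2)%N = (N * 2).+1.+1)//; exact: all_moments_powers.
  + by apply/measurable_EFinP/measurable_funX; exact: measurableT_comp.
Qed.
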